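(* In the UL-UN setting with quota $k$ and known number $n$ of released sub-intervals, where $2\le k\le n-1$, the algorithm SOA runs in $O(n)$ time and achieves a competitive ratio no larger than $$\min\Big\{\frac{\sqrt{1+2(k-1)(n-k)}-1}{k-1}+1,\ \frac{\sqrt{9k^2-14k+9}-k-1}{2(k-1)}+1\Big\}.$$
   Context: Online maximum $k$-interval coverage problem: there is a target interval $[0,a]$. Sub-intervals $V_1,\dots,V_n$ with $V_i=[o_i,d_i]\subseteq[0,a]$ are released one at a time in an adversarial order; on the release of $V_i$ the algorithm must immediately and irrevocably accept or reject it. At most $k$ may be accepted. For a set $U$ of sub-intervals let $Len(U)=|\bigcup_{V\in U}V|$; the goal is to maximize $Len(U)$ for the accepted set. $\mathrm{OPT}(\mathbb{V})$ is the maximum of $Len(U)$ over $U\subseteq\mathbb{V}$, $|U|\le k$; ALG is $\rho$-competitive if $\mathrm{OPT}(\mathbb{V})\le\rho\,\mathrm{ALG}(\mathbb{V})$ for all instances. UL-UN setting: every sub-interval has length exactly $1$ and $n$ is known in advance. Algorithm SOA: let $\theta=\min\{\frac{\sqrt{1+2(k-1)(n-k)}-1}{2k-2},\frac{\sqrt{9k^2-14k+9}-k-1}{4(k-1)}\}$. SOA accepts $V_1$. For $i=2,\dots,n$, let $\Phi_{i-1}$ be the set accepted among $V_1,\dots,V_{i-1}$: if $|\Phi_{i-1}|=k$, SOA stops (rejects all remaining); else if $k-|\Phi_{i-1}|\ge n-i+1$, it accepts $V_i$ (quota-enough condition); else it accepts $V_i$ iff $Len(\Phi_{i-1}\cup\{V_i\})-Len(\Phi_{i-1})\ge\theta$,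 and rejects it otherwise. *)

(* Defs.v *)
From HB Require Import structures.
From mathcomp Require Import all_boot all_order all_algebra.
From mathcomp Require Import all_classical all_reals all_analysis.

Set Implicit Arguments.
Unset Strict Implicit.
Unset Printing Implicit Defensive.

Import Order.TTheory GRing.Theory Num.Theory.

Local Open Scope ring_scope.

Section Coverage.
Context {R : realType}.

(* The released sub-intervals, in release order: [V i = (o, d)] is the
   (i+1)-st released sub-interval [o, d], indices being 0-based. A set of
   sub-intervals is a set of indices, so that two releases of the same interval
   are two distinct items for the quota. *)
Definition intervals (n : nat) := 'I_n -> R * R.

Definition unit_length_in (a : R) (n : nat) (V : intervals n) : Prop :=
  forall i, [/\ 0 <= (V i).1, (V i).2 <= a & (V i).2 - (V i).1 = 1].

Definition Len (n : nat) (V : intervals n) (U : {set 'I_n}) : R :=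
  fine (@lebesgue_measure R
    (\bigcup_(i in [set i | i \in U]) `[(V i).1, (V i).2])%classic).

(* The default value 0 is [Len V set0], so it does not affect the maximum. *)
Definition OPT (k n : nat) (V : intervals n) : R :=
  \big[Num.max/0]_(U : {set 'I_n} | (#|U| <= k)%N) Len V U.

Definition competitive (k n : nat) (ALG : intervals n -> {set 'I_n})
    (rho : R) : Prop :=
  forall (a : R) (V : intervals n), unit_length_in a V ->
    OPT k V <= rho * Len V (ALG V).

Definition theta (k n : nat) : R :=
  let K := k%:R in let N := n%:R in
  Num.min
    ((Num.sqrt (1 + 2 * (K - 1) * (N - K)) - 1) / (2 * K - 2))
    ((Num.sqrt (9 * K ^+ 2 - 14 * K + 9) - K - 1) / (4 * (K - 1))).

(* The decision on [V i] when [Phi] is the set accepted so far. With 0-based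
   [i], the number of releases still to be decided (this one included) is
   [n - i]. Stopping once the quota is exhausted means rejecting everything
   that follows. *)
Definition SOA_accepts (k n : nat) (V : intervals n) (Phi : {set 'I_n})
    (i : 'I_n) : bool :=
  if i == 0%N :> nat then true
  else if #|Phi| == k then false
  else if (n - i <= k - #|Phi|)%N then true
  else theta k n <= Len V (i |: Phi) - Len V Phi.

Definition SOA (k n : nat) (V : intervals n) : {set 'I_n} :=
  foldl (fun Phi i => if SOA_accepts k V Phi i then i |: Phi else Phi)
        finset.set0 (enum 'I_n).

End Coverage.

(* Running time is measured on a real RAM with indirect addressing: the memory
   is a sequence of reals, and arithmetic operations, square root, floor,
   comparison and memory access have unit cost. Lengths of unions are not
   primitive. The syntax mentions only natural constants, so a program cannot
   depend on the instance. *)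
Inductive expr : Type :=
| Cst of nat
| Mem of expr
| Add of expr & expr
| Sub of expr & expr
| Mul of expr & expr
| Div of expr & expr
| Sqrt of expr
| Floor of expr.

Inductive cmd : Type :=
| Skip
| Store of expr & expr
| Seq of cmd & cmd
| If of expr & expr & cmd & cmd
| While of expr & expr & cmd.

Section RealRAM.
Context {R : realType}.

Definition memory := nat -> R.

Definition upd (m : memory) (x : nat) (v : R) : memory :=
  fun y => if y == x then v else m y.

(* A real used as an address is truncated to a natural number (negative reals
   give address 0). [Div] by 0 and [Sqrt] of a negative number give 0. *)
Fixpoint eval (m : memory) (e : expr) : R :=
  match e with
  | Cst c => c%:R
  | Mem e1 => m (Num.truncn (eval m e1))
  | Add e1 e2 => eval m e1 + eval m e2
  | Sub e1 e2 => eval m e1 - eval m e2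
  | Mul e1 e2 => eval m e1 * eval m e2
  | Div e1 e2 => eval m e1 / eval m e2
  | Sqrt e1 => Num.sqrt (eval m e1)
  | Floor e1 => (Num.floor (eval m e1))%:~R
  end.

Fixpoint cost (e : expr) : nat :=
  match e with
  | Cst _ => 1
  | Mem e1 | Sqrt e1 | Floor e1 => (cost e1).+1
  | Add e1 e2 | Sub e1 e2 | Mul e1 e2 | Div e1 e2 => (cost e1 + cost e2).+1
  end.

(* [exec c m m' t]: from memory [m], [c] halts with memory [m'] after [t]
   steps. [If] and [While] test [e1 <= e2]. *)
Inductive exec : cmd -> memory -> memory -> nat -> Prop :=
| ExecSkip m : exec Skip m m 1
| ExecStore e1 e2 m :
    exec (Store e1 e2) m (upd m (Num.truncn (eval m e1)) (eval m e2))
         (cost e1 + cost e2).+1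
| ExecSeq c1 c2 m1 m2 m3 t1 t2 :
    exec c1 m1 m2 t1 -> exec c2 m2 m3 t2 ->
    exec (Seq c1 c2) m1 m3 (t1 + t2).+1
| ExecIfTrue e1 e2 c1 c2 m m' t :
    eval m e1 <= eval m e2 -> exec c1 m m' t ->
    exec (If e1 e2 c1 c2) m m' (cost e1 + cost e2 + t).+1
| ExecIfFalse e1 e2 c1 c2 m m' t :
    eval m e2 < eval m e1 -> exec c2 m m' t ->
    exec (If e1 e2 c1 c2) m m' (cost e1 + cost e2 + t).+1
| ExecWhileTrue e1 e2 c m1 m2 m3 t1 t2 :
    eval m1 e1 <= eval m1 e2 -> exec c m1 m2 t1 ->
    exec (While e1 e2 c) m2 m3 t2 ->
    exec (While e1 e2 c) m1 m3 (cost e1 + cost e2 + t1 + t2).+1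
| ExecWhileFalse e1 e2 c m :
    eval m e2 < eval m e1 ->
    exec (While e1 e2 c) m m (cost e1 + cost e2).+1.

(* The initial memory holds [n] and [k] in cells 0 and 1, and 0 elsewhere. *)
Definition start (n k : nat) : memory :=
  upd (upd (fun _ => 0) 0 n%:R) 1 k%:R.

(* A release writes the end points into cells 2 and 3, at cost 1. *)
Definition release (m : memory) (v : R * R) : memory :=
  upd (upd m 2 v.1) 3 v.2.

(* The handler is run on each release in turn, and keeps its memory from one
   release to the next; it accepts iff it halts with a non-zero cell 4. *)
Inductive serve (handler : cmd) :
    memory -> seq (R * R) -> seq bool -> nat -> Prop :=
| ServeNil m : serve handler m [::] [::] 0
| ServeCons m m' v s bs t ts :
    exec handler (release m v) m' t ->
    serve handler m' s bs ts ->
    serve handler m (v :: s) ((m' 4%N != 0) :: bs) (t + ts).+1.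

(* [init] is run once, before the first release. *)
Definition decides (init handler : cmd) (k n : nat) (V : intervals (R := R) n)
    (A : {set 'I_n}) (t : nat) : Prop :=
  exists (m : memory) (t0 t1 : nat),
    [/\ exec init (start n k) m t0,
        serve handler m [seq V i | i <- enum 'I_n]
              [seq i \in A | i <- enum 'I_n] t1
      & t = (t0 + t1)%N].

End RealRAM.

(* Main.v *)
(** The guarantee is 1 + 2 theta, where theta is the smaller of the positive
    roots of 2 x (1 + (k - 1) x) = n - k and (1 + 2 x) (1 + (k - 1) x) = k.
    If SOA fills its quota with intervals each gaining at least theta, its value
    is at least 1 + (k - 1) theta, while the optimum is at most k and exceeds it
    by at most the number n - k of rejected intervals; the two equations conclude.
    Otherwise every rejected interval has less than theta left uncovered, so it
    lies in the theta-neighbourhood of the accepted union. This neighbourhood is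
    a union of intervals of length 1 + 2 theta concentric with the accepted ones,
    hence at most 1 + 2 theta times as large as the accepted union.

    For the running time, accepted intervals are grouped by the integer part of
    their left end point. Two numbers per group determine the union, and the gain
    of a new interval depends on four of them, so that a release is served in
    constant time. *)
Require Import Defs.
From HB Require Import structures.
From mathcomp Require Import all_boot all_order all_algebra.
From mathcomp Require Import all_classical all_reals all_analysis.
From mathcomp Require Import zify ring lra.

Import Order.TTheory GRing.Theory Num.Theory.

Local Open Scope ring_scope.

(** * Covered length and marginal gains *)

Section Coverage.
Set Implicit Arguments.
Unset Strict Implicit.
Context {R : realType}.
Notation mu := (@lebesgue_measure R).

Lemma itv_measure (b1 b2 : bool) (a b : R) :
  mu [set` Interval (BSide b1 a) (BSide b2 b)]%classic = (Num.max 0 (b - a))%:E.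
Proof.
rewrite lebesgue_measure_itv /= lte_fin.
by case: ltP => ab; rewrite ?EFinN -?EFinD; congr EFin; case: ltP; lra.
Qed.

Lemma measurable_cc (a b : R) : measurable (`[a, b]%classic : set R).
Proof. exact: measurable_itv. Qed.

Lemma le_mu (A B : set R) :
  measurable A -> measurable B -> (A `<=` B)%classic -> (mu A <= mu B)%E.
Proof. by move=> mA mB AB; apply: (le_measure mu) => //; rewrite inE. Qed.

Lemma mu_disjU (A B : set R) : measurable A -> measurable B ->
  (forall x, A x -> B x -> False) -> (mu (A `|` B)%classic = mu A + mu B)%E.
Proof.
move=> mA mB AB; apply: measureU; [exact: mA|exact: mB|].
by apply/seteqP; split => // x [Ax Bx]; exact: AB Bx.
Qed.

Lemma mu_U2 (A B : set R) :
  measurable A -> measurable B -> (mu (A `|` B)%classic <= mu A + mu B)%E.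
Proof. by move=> mA mB; apply: measureU2; [exact: mA|exact: mB]. Qed.

Definition covered (n : nat) (V : intervals n) (U : {set 'I_n}) : set R :=
  (\bigcup_(i in [set i | i \in U]) `[(V i).1, (V i).2])%classic.

Definition gain (n : nat) (V : intervals n) (U : {set 'I_n}) (i : 'I_n) : R :=
  fine (mu (`[(V i).1, (V i).2]%classic `\` covered V U)%classic).

Lemma measurable_covered (n : nat) (V : intervals n) (U : {set 'I_n}) :
  measurable (covered V U).
Proof.
apply: fin_bigcup_measurable => [|i _]; last exact: measurable_cc.
exact: finite_finset.
Qed.

Lemma measurable_uncovered (n : nat) (V : intervals n) (U : {set 'I_n}) i :
  measurable (`[(V i).1, (V i).2]%classic `\` covered V U)%classic.
Proof. by apply: measurableD; [exact: measurable_cc|exact: measurable_covered]. Qed.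

Hint Resolve measurable_cc measurable_covered measurable_uncovered : core.

Section Instance.
Context (a : R) (n : nat) (V : intervals n) (unitV : unit_length_in a V).

Lemma right_end i : (V i).2 = (V i).1 + 1.
Proof. by have [_ _ <-] := unitV i; rewrite addrC subrK. Qed.

Lemma gainE U i :
  (gain V U i)%:E = mu (`[(V i).1, (V i).2]%classic `\` covered V U)%classic.
Proof.
rewrite fineK// ge0_fin_numE//.
apply: (@le_lt_trans _ _ (mu `[(V i).1, (V i).2]%classic)).
  by apply: le_mu => //; exact: subDsetl.
by rewrite itv_measure ltry.
Qed.

Lemma LenE U : (Len V U)%:E = mu (covered V U).
Proof.
rewrite -[Len V U]/(fine (mu (covered V U))) fineK// ge0_fin_numE//.
apply: (@le_lt_trans _ _ (mu `[0, a]%classic)); last by rewrite itv_measure ltry.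
apply: le_mu => // x [i _] /=; rewrite !in_itv/= => /andP[? ?].
by have [? ? _] := unitV i; lra.
Qed.

Lemma Len_setU1 U i : Len V (i |: U) = Len V U + gain V U i.
Proof.
apply: EFin_inj; rewrite EFinD !LenE gainE.
have -> : covered V (i |: U) =
    (covered V U `|` (`[(V i).1, (V i).2]%classic `\` covered V U))%classic.
  apply/seteqP; split => [x [j /=]|x].
    rewrite !inE => /orP[/eqP-> xi|jU xj]; last by left; exists j.
    by have [|] := pselect (covered V U x); [left|right].
  case=> [[j /= jU xj]|[xi _]]; first by exists j => //=; rewrite !inE jU orbT.
  by exists i => //=; rewrite !inE eqxx.
by apply: mu_disjU => // x xU [_]; apply.
Qed.

Lemma covered_sub (U W : {set 'I_n}) :
  U \subset W -> (covered V U `<=` covered V W)%classic.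
Proof. by move=> /fintype.subsetP UW x [i /= /UW iW xi]; exists i. Qed.

(** Submodularity of coverage: a gain below the threshold at the time of a rejection stays below it
    as more intervals are accepted. *)
Lemma gain_sub (U W : {set 'I_n}) i : U \subset W -> gain V W i <= gain V U i.
Proof.
move=> UW; rewrite -lee_fin !gainE le_mu//.
by apply: setDS; exact: covered_sub.
Qed.

Lemma gain_le1 U i : gain V U i <= 1.
Proof.
rewrite -lee_fin gainE; apply: (@le_trans _ _ (mu `[(V i).1, (V i).2]%classic)).
  by apply: le_mu => //; exact: subDsetl.
by rewrite itv_measure lee_fin right_end addrAC subrr add0r max_r.
Qed.

Lemma covered0 : covered V finset.set0 = classical_sets.set0.
Proof. by apply/seteqP; split => // x [i /=]; rewrite inE. Qed.

Lemma gain0 i : gain V finset.set0 i = 1.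
Proof.
apply: EFin_inj; rewrite gainE covered0 setD0 itv_measure right_end.
by congr EFin; rewrite addrAC subrr add0r; apply/max_idPr.
Qed.

Lemma Len0 : Len V finset.set0 = 0.
Proof. by apply: EFin_inj; rewrite LenE covered0 measure0. Qed.

Lemma gain_ge0 U i : 0 <= gain V U i.
Proof. exact: fine_ge0. Qed.

Lemma Len_sub (U W : {set 'I_n}) : U \subset W -> Len V U <= Len V W.
Proof. by move=> UW; rewrite -lee_fin !LenE le_mu//; exact: covered_sub. Qed.

(** Each interval gains at most 1. With [U] empty this bounds the optimum by [k]; with [U] the
    accepted set it bounds the excess of the optimum by the number of rejected intervals. *)
Lemma Len_setU_card (U W : {set 'I_n}) : Len V (W :|: U) <= Len V U + #|W|%:R.
Proof.
have [m] := ubnP #|W|; elim: m W => // m IHm W.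
have [->|/set0Pn[i iW]] := eqVneq W finset.set0.
  by rewrite finset.set0U cards0 addr0.
rewrite (cardsD1 i W) iW add1n ltnS => Wm.
have -> : W :|: U = i |: (W :\ i :|: U) by rewrite finset.setUA finset.setD1K.
rewrite Len_setU1 -natr1.
have := IHm _ Wm; have := gain_le1 (W :\ i :|: U) i; lra.
Qed.

End Instance.
End Coverage.

(** * Thickening a union of unit intervals *)

Section Expansion.
Set Implicit Arguments.
Unset Strict Implicit.
Context {R : realType}.
Notation mu := (@lebesgue_measure R).

(** The start points form a list rather than an index set, so that they can be sorted; [r = 0] gives
    back the covered set. *)
Definition thick (r : R) (s : seq R) : set R :=
  \big[setU/classical_sets.set0]_(y <- s) `[y - r, y + 1 + r]%classic.

Lemma thickP (r : R) (s : seq R) (x : R) :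
  thick r s x <-> exists2 y, y \in s & y - r <= x <= y + 1 + r.
Proof.
rewrite /thick -bigcup_seq.
by split=> [[y ys /=]|[y ys yx]]; [|exists y]; rewrite //= in_itv/=; exists y.
Qed.

Lemma measurable_thick (r : R) (s : seq R) : measurable (thick r s).
Proof. by apply: bigsetU_measurable => y _; exact: measurable_cc. Qed.

(* Both sides are built from the left: for sorted starting points, an interval
   of length [w] whose start is [d] after the previous one adds [min w d] to the
   measure of the union, and [min (1 + 2 r) d <= (1 + 2 r) min 1 d]. *)
Lemma measure_thick (r : R) (s : seq R) : 0 <= r -> sorted >=%R s ->
  (mu (thick r s) <= (1 + 2 * r)%:E * mu (thick 0 s))%E.
Proof.
move=> r0; elim: s => [|y [|z s] IHs].
- by rewrite /thick !big_nil !measure0 mule0.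
- rewrite /thick !big_seq1 !itv_measure -EFinM lee_fin => _.
  by rewrite !max_r; lra.
move=> /= /andP[zy zs].
have {}IHs := IHs zs.
have le_z t : t \in z :: s -> t <= z.
  rewrite inE => /predU1P[->//|ts].
  by have /allP/(_ t ts) := order_path_min (rev_trans le_trans) zs.
(* The rightmost start is [y] and the next one is [z], so [new] is what [y] adds beyond the interval
   of [z]. Its left end is closed in the upper bound, which must cover everything, and open in the
   lower bound, which needs disjointness. *)
pose new b q : set R :=
  [set` Interval (BSide b (Num.max (z + 1 + q) (y - q))) (BRight (y + 1 + q))]%classic.
have mnew b q : measurable (new b q) by exact: measurable_itv.
have upper :
    (mu (thick r [:: y, z & s]) <= mu (thick r (z :: s)) + mu (new true r))%E.
  apply: le_trans (mu_U2 _ _) => //; last exact: measurable_thick.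
  apply: le_mu; [exact: measurable_thick| |].
    by apply: measurableU => //; exact: measurable_thick.
  move=> x /thickP[t]; rewrite inE => /predU1P[->|ts] /andP[tx xt]; last first.
    by left; apply/thickP; exists t => //; apply/andP.
  have [xz|zx] := leP x (z + 1 + r).
    by left; apply/thickP; exists z; rewrite ?mem_head//; apply/andP; split; lra.
  by right; rewrite /new /= in_itv/= ge_max (ltW zx) tx xt.
have lower : (mu (thick 0 (z :: s)) + mu (new false 0%R) <= mu (thick 0 [:: y, z & s]))%E.
  rewrite -mu_disjU; [|exact: measurable_thick|exact: mnew|].
    apply: le_mu; [|exact: measurable_thick|].
      by apply: measurableU => //; exact: measurable_thick.
    move=> x [/thickP[t ts tx]|]; first by apply/thickP; exists t; rewrite // inE ts orbT.
    rewrite /new /= in_itv/= gt_max => /andP[/andP[zx yx] xy].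
    by apply/thickP; exists y; rewrite ?mem_head//; apply/andP; split; lra.
  move=> x /thickP[t /le_z tz] /andP[_ xt].
  by rewrite /new /= in_itv/= gt_max => /andP[/andP[zx _] _]; lra.
apply: (le_trans upper).
apply: le_trans; last by apply: lee_wpmul2l lower; rewrite lee_fin; lra.
rewrite ge0_muleDr//; apply: leeD => //.
rewrite /new !itv_measure -EFinM lee_fin.
have [h1|h1] := leP (z + 1 + r) (y - r); have [h2|h2] := leP (z + 1 + 0) (y - 0);
  rewrite ?max_r; nra.
Qed.

Context (a : R) (n : nat) (V : intervals n) (unitV : unit_length_in a V).

Let starts (U : {set 'I_n}) := sort >=%R [seq (V i).1 | i <- enum U].

Lemma mem_starts (U : {set 'I_n}) i : i \in U -> (V i).1 \in starts U.
Proof. by move=> iU; rewrite mem_sort; apply/mapP; exists i; rewrite ?mem_enum. Qed.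

Lemma covered_thick (U : {set 'I_n}) : covered V U = thick 0 (starts U).
Proof.
apply/seteqP; split => x; rewrite thickP.
  case=> i /= iU; rewrite in_itv/= (right_end unitV) => xi.
  exists (V i).1; last by rewrite subr0 addr0.
  exact: mem_starts.
case=> y; rewrite mem_sort => /mapP[i]; rewrite mem_enum => iU ->.
by rewrite subr0 addr0 => xi; exists i; rewrite //= in_itv/= (right_end unitV).
Qed.

(** If [x] were farther than [r] from every accepted interval, the part of []x - r, x + r[] inside
    [V j] would be uncovered. Its length is at least [r], because [x] lies in [V j] and [r <= 1]. *)
Lemma small_gain_near (U : {set 'I_n}) (r : R) (j : 'I_n) (x : R) :
  r <= 1 -> gain V U j < r -> (V j).1 <= x <= (V j).2 -> thick r (starts U) x.
Proof.
move=> r1 gr; rewrite (right_end unitV) => /andP[jx xj].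
have r0 : 0 <= r by apply: le_trans (ltW gr); exact: gain_ge0.
have [//|far] := pselect (thick r (starts U) x).
suff: r <= gain V U j by lra.
set u := Num.max (V j).1 (x - r); set v := Num.min ((V j).1 + 1) (x + r).
have vu : r <= v - u.
  by rewrite /u /v; have [h|h] := leP (V j).1 (x - r);
  have [h2|h2] := leP ((V j).1 + 1) (x + r); lra.
rewrite -lee_fin gainE.
apply: (@le_trans _ _ (mu `]u, v[%classic)).
  by rewrite itv_measure lee_fin le_max vu orbT.
apply: le_mu; [exact: measurable_itv|exact: measurable_uncovered|].
move=> t /=; rewrite in_itv/= gt_max lt_min => /andP[/andP[jt xt] /andP[tj tx]].
split; first by rewrite /= in_itv/= (right_end unitV); apply/andP; split; lra.
case=> i /= iU; rewrite in_itv/= (right_end unitV) => /andP[it ti].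
apply: far; apply/thickP; exists (V i).1; first exact: mem_starts.
by apply/andP; split; lra.
Qed.

Lemma Len_small_gains (U W : {set 'I_n}) (r : R) : 0 <= r <= 1 ->
  (forall j, j \notin U -> gain V U j < r) -> Len V W <= (1 + 2 * r) * Len V U.
Proof.
move=> /andP[r0 r1] small; rewrite -lee_fin EFinM !(LenE unitV).
apply: (@le_trans _ _ (mu (thick r (starts U)))); last first.
  rewrite covered_thick; apply: measure_thick => //.
  by apply: sort_sorted => x y; exact: le_total.
apply: le_mu; [exact: measurable_covered|exact: measurable_thick|].
move=> x [j /= jW]; rewrite in_itv/= => xj.
have [jU|/small/small_gain_near] := boolP (j \in U); last exact.
apply/thickP; exists (V j).1; first exact: mem_starts.
by move: xj; rewrite (right_end unitV) => /andP[? ?]; apply/andP; split; lra.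
Qed.

End Expansion.

Lemma foldl_ord_ind (T : Type) (n : nat) (f : T -> 'I_n -> T) (x0 : T)
    (P : nat -> T -> Prop) :
  P 0%N x0 -> (forall x (i : 'I_n), P i x -> P i.+1 (f x i)) ->
  P n (foldl f x0 (enum 'I_n)).
Proof.
move=> P0 PS.
(* The induction runs over lists of consecutive ordinals starting at any [m], such as the tails of
   [enum 'I_n]. *)
suff gen (s : seq 'I_n) m x : map val s = iota m (size s) -> P m x ->
    P (m + size s)%N (foldl f x s).
  have := gen (enum 'I_n) 0%N x0; rewrite val_enum_ord size_enum_ord.
  by apply.
elim: s m x => [|i s IHs] m x /=; first by rewrite addn0.
by case=> im sm Pm; rewrite addnS -addSn; apply: IHs => //; rewrite -im; apply: PS; rewrite im.
Qed.

(** * The threshold and the competitive ratio *)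

Section Threshold.
Set Implicit Arguments.
Unset Strict Implicit.
Context {R : realType} (k n : nat) (k2 : (2 <= k)%N) (kn : (k < n)%N).

Lemma K_ge2 : 2 <= k%:R :> R. Proof. by rewrite (ler_nat _ 2). Qed.
Lemma K_ltN : k%:R + 1 <= n%:R :> R. Proof. by rewrite natr1 ler_nat. Qed.

Definition theta1 : R :=
  (Num.sqrt (1 + 2 * (k%:R - 1) * (n%:R - k%:R)) - 1) / (2 * k%:R - 2).
Definition theta2 : R :=
  (Num.sqrt (9 * k%:R ^+ 2 - 14 * k%:R + 9) - k%:R - 1) / (4 * (k%:R - 1)).

(** With [L = 1 + (k - 1) theta1], this balances [(1 + 2 theta1) L] against [L + (n - k)], the bound
    on the optimum when the filled quota is worth [L]. *)
Lemma theta1_eq : 2 * theta1 * (1 + (k%:R - 1) * theta1) = n%:R - k%:R.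
Proof.
have k2R := K_ge2; have knR := K_ltN.
have D0 : 0 <= 1 + 2 * (k%:R - 1) * (n%:R - k%:R) :> R by nra.
have := sqr_sqrtr D0; rewrite /theta1; set s := Num.sqrt _ => ss.
have -> : n%:R - k%:R = (s ^+ 2 - 1) / (2 * (k%:R - 1)) :> R.
  by rewrite ss; field; lra.
by field; lra.
Qed.

Lemma theta1_ge0 : 0 <= theta1.
Proof.
have k2R := K_ge2; have knR := K_ltN.
rewrite /theta1; apply: divr_ge0; last by rewrite subr_ge0 ler_peMr; lra.
rewrite subr_ge0 -[leLHS](sqrtr1 R) ler_wsqrtr// lerDl.
by apply: mulr_ge0; lra.
Qed.

(** Here the balance is against the other bound on the optimum, [k]. *)
Lemma theta2_eq : (1 + 2 * theta2) * (1 + (k%:R - 1) * theta2) = k%:R.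
Proof.
have k2R := K_ge2; have knR := K_ltN.
have D0 : 0 <= 9 * k%:R ^+ 2 - 14 * k%:R + 9 :> R by nra.
have := sqr_sqrtr D0; rewrite /theta2; set s := Num.sqrt _ => ss.
(* The factors are [(s + k - 3) / (2 (k - 1))] and [(s - k + 3) / 4], whence a difference of
   squares; the radicand minus [(k - 3) ^ 2] is [8 k (k - 1)]. *)
suff : (1 + 2 * ((s - k%:R - 1) / (4 * (k%:R - 1)))) *
    (1 + (k%:R - 1) * ((s - k%:R - 1) / (4 * (k%:R - 1)))) =
    (s ^+ 2 - (k%:R - 3) ^+ 2) / (8 * (k%:R - 1)).
  by move=> ->; rewrite ss; field; lra.
by field; lra.
Qed.

Lemma theta2_ge0 : 0 <= theta2.
Proof.
have k2R := K_ge2; have knR := K_ltN.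
rewrite /theta2; apply: divr_ge0; last by apply: mulr_ge0; lra.
rewrite -addrA -opprD subr_ge0.
(* The radicand exceeds [(k + 1) ^ 2] by [8 (k - 1) ^ 2]. *)
have {1}-> : k%:R + 1 = Num.sqrt ((k%:R + 1) ^+ 2) :> R.
  by rewrite sqrtr_sqr ger0_norm//; lra.
by rewrite ler_wsqrtr//; nra.
Qed.

Lemma theta_min : theta k n = Num.min theta1 theta2.
Proof. by []. Qed.

Lemma theta_ge0 : 0 <= theta k n :> R.
Proof. by rewrite le_min theta1_ge0 theta2_ge0. Qed.

(** If [theta2] exceeded 1, the product in [theta2_eq] would exceed [3 k]. The bound lets the first
    interval, of gain 1, pass the threshold test, and makes [Len_small_gains] applicable. *)
Lemma theta_le1 : theta k n <= 1 :> R.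
Proof.
have k2R := K_ge2; have knR := K_ltN.
rewrite ge_min; apply/orP; right; rewrite -/theta2.
by have := theta2_eq; have := theta2_ge0; nra.
Qed.

Lemma ratio_eq :
  Num.min
    ((Num.sqrt (1 + 2 * (k%:R - 1) * (n%:R - k%:R)) - 1) / (k%:R - 1) + 1)
    ((Num.sqrt (9 * k%:R ^+ 2 - 14 * k%:R + 9) - k%:R - 1)
       / (2 * (k%:R - 1)) + 1) = 1 + 2 * theta k n :> R.
Proof.
have k2R := K_ge2; have knR := K_ltN.
rewrite theta_min; have -> : (Num.sqrt (1 + 2 * (k%:R - 1) * (n%:R - k%:R)) - 1) / (k%:R - 1) + 1 =
   1 + 2 * theta1 :> R by rewrite /theta1; field; lra.
have -> : (Num.sqrt (9 * k%:R ^+ 2 - 14 * k%:R + 9) - k%:R - 1)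
   / (2 * (k%:R - 1)) + 1 = 1 + 2 * theta2 :> R by rewrite /theta2; field; lra.
have /orP[h|h] := le_total theta1 theta2.
  by rewrite (min_l h) min_l//; lra.
by rewrite (min_r h) min_r//; lra.
Qed.

Context (a : R) (V : intervals n) (unitV : unit_length_in a V).

(** The special case of the first release is absorbed by the threshold test, since its gain is 1.
    This is the form that the program tests. *)
Lemma SOA_acceptsE (Phi : {set 'I_n}) (i : 'I_n) :
  (forall j, j \in Phi -> (j < i)%N) -> (#|Phi| <= k)%N ->
  SOA_accepts k V Phi i =
  (0 < k - #|Phi|)%N && ((n - i <= k - #|Phi|)%N || (theta k n <= gain V Phi i)).
Proof.
move=> ltPhi Phik; rewrite /SOA_accepts (Len_setU1 unitV) addrAC subrr add0r.
case: eqVneq => [i0|_].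
  have -> : Phi = finset.set0.
    by apply/setP => j; rewrite inE; apply/negP => /ltPhi; rewrite i0.
  by rewrite cards0 (gain0 unitV) theta_le1 orbT andbT subn0 (ltnW k2).
case: eqVneq => [->|]; first by rewrite subnn.
by move=> neq; rewrite subn_gt0 ltn_neqAle neq Phik /=; case: ifP.
Qed.

Let step (Phi : {set 'I_n}) i := if SOA_accepts k V Phi i then i |: Phi else Phi.

Let small (i : nat) (Phi : {set 'I_n}) :=
  forall j : 'I_n, (j < i)%N -> j \notin Phi -> gain V Phi j < theta k n.

Lemma small_accept (i : 'I_n) (Phi : {set 'I_n}) :
  small i Phi -> small i.+1 (i |: Phi).
Proof.
move=> sm j; rewrite ltnS leq_eqVlt !inE negb_or.
case/predU1P => [/val_inj->|ji /andP[_ jPhi]]; first by rewrite eqxx.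
by apply: le_lt_trans (sm _ ji jPhi); apply: gain_sub; exact: finset.subsetUr.
Qed.

(** The first alternative is the threshold phase, the second the quota-enough phase, where every
    remaining release will be accepted. The empty set is set apart because [1 - theta] may be
    positive. *)
Let invariant (i : nat) (Phi : {set 'I_n}) :=
  [/\ forall j, j \in Phi -> (j < i)%N,
      (#|Phi| <= k <= #|Phi| + (n - i))%N
    & ((#|Phi| = 0%N \/ 1 + (#|Phi|%:R - 1) * theta k n <= Len V Phi) /\
       (small i Phi \/ #|Phi| = k)) \/
      (small i Phi /\ k = (#|Phi| + (n - i))%N)].

Lemma invariant_step (Phi : {set 'I_n}) (i : 'I_n) :
  invariant i Phi -> invariant i.+1 (step Phi i).
Proof.
case=> ltPhi /andP[Phik kPhi] inv.
have iPhi : i \notin Phi by apply/negP => /ltPhi; rewrite ltnn.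
have ltPhi' j : j \in i |: Phi -> (j < i.+1)%N.
  by rewrite !inE ltnS leq_eqVlt => /predU1P[->|/ltPhi->]; rewrite ?eqxx ?orbT.
have ltin := ltn_ord i.
rewrite /step SOA_acceptsE//.
have [quota|full] := ltnP 0 (k - #|Phi|); last first.
  have Phi_k : #|Phi| = k by lia.
  split => /=; [by move=> j /ltPhi/ltnW|by rewrite Phi_k leqnn leq_addr|left; split; last by right].
  by case: inv => [[]//|[_ ?]]; exfalso; lia.
have card' : #|i |: Phi| = #|Phi|.+1 by rewrite cardsU1 iPhi.
have sm : small i Phi by case: inv => [[_ [//|Phi_k]]|[]//]; exfalso; lia.
have [enough|scarce] /= := leqP (n - i) (k - #|Phi|).
  (* As [k <= #|Phi| + (n - i)], the quota-enough condition is an equality, which accepting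
     preserves. *)
  split => //; first by rewrite card'; lia.
  by right; split; [exact: small_accept|rewrite card'; lia].
have {inv} thr : #|Phi| = 0%N \/ 1 + (#|Phi|%:R - 1) * theta k n <= Len V Phi.
  by case: inv => [[]//|[_ ?]]; exfalso; lia.
have [large|less] := leP (theta k n) (gain V Phi i); split => //.
- by rewrite card'; lia.
- left; split; last by left; exact: small_accept.
  right; rewrite card' (Len_setU1 unitV) -natr1.
  case: thr => [Phi0|]; last lra.
  have -> : Phi = finset.set0 by apply/eqP; rewrite -cards_eq0 Phi0.
  by rewrite (Len0 unitV) (gain0 unitV) cards0; lra.
- by move=> j /ltPhi/ltnW.
- lia.
- left; split => //; left => j; rewrite ltnS leq_eqVlt.
  by case/predU1P => [/val_inj->//|]; exact: sm.
Qed.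

(* Either the quota was filled by intervals each gaining [theta], or every
   rejected interval would gain less than [theta]. *)
Lemma SOA_dichotomy : let Phi := SOA k V in
  (#|Phi| = k /\ 1 + (k%:R - 1) * theta k n <= Len V Phi) \/
  (forall j, j \notin Phi -> gain V Phi j < theta k n).
Proof.
have : invariant n (SOA k V).
  apply: (@foldl_ord_ind _ _ step); last exact: invariant_step.
  split => [j||]; rewrite ?inE ?cards0 ?subn0//; first lia.
  by left; split; [left|left => j].
case=> _; rewrite subnn addn0 => /anti_leq Phik [[thr [sm|_]]|[sm _]].
- by right => j; apply: sm.
- by left; split => //; case: thr; rewrite Phik//; lia.
- by right => j; apply: sm.
Qed.

Lemma SOA_competitive : OPT k V <= (1 + 2 * theta k n) * Len V (SOA k V).
Proof.
have k2R := K_ge2; have knR := K_ltN.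
have th0 := theta_ge0; have th1 := theta_le1.
have L0 : 0 <= Len V (SOA k V) by exact: fine_ge0.
apply: bigmax_le => [|U Uk]; first by apply: mulr_ge0 => //; lra.
have [[Phik thr]|small_gain] := SOA_dichotomy; last first.
  by apply: (Len_small_gains unitV) => //; rewrite th0 th1.
have /orP[th|th] := le_total theta1 theta2.
- have {th} th : theta k n = theta1 by rewrite [theta k n]min_l.
  have : Len V U <= Len V (SOA k V) + (n%:R - k%:R).
    apply: (@le_trans _ _ (Len V (U :\: SOA k V :|: SOA k V))).
      apply: (Len_sub unitV); apply/fintype.subsetP => j; rewrite !inE => ->.
      by rewrite andbT orNb.
    apply: le_trans (Len_setU_card unitV _ _) _; rewrite lerD2l -natrB 1?ltnW// ler_nat.
    have UC : (#|U :\: SOA k V| <= #|~: SOA k V|)%N.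
      by apply: subset_leq_card; apply/fintype.subsetP => j; rewrite !inE => /andP[].
    by have := cardsC (SOA k V); rewrite Phik card_ord; lia.
  by have := theta1_eq; rewrite -th; nra.
- have {th} th : theta k n = theta2 by rewrite theta_min min_r.
  have : Len V U <= k%:R.
    have := Len_setU_card unitV finset.set0 U; rewrite finset.setU0 (Len0 unitV) add0r.
    by move=> /le_trans; apply; rewrite ler_nat.
  by have := theta2_eq; rewrite -th; nra.
Qed.

End Threshold.

(** * Computing gains from bucket data *)

Section Buckets.
Set Implicit Arguments.
Unset Strict Implicit.
Context {R : realType} (n : nat) (V : intervals (R := R) n).
Notation mu := (@lebesgue_measure R).

Definition bucket (i : 'I_n) : nat := Num.truncn (V i).1.
Definition frac (i : 'I_n) : R := (V i).1 - (bucket i)%:R.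

(* The unit intervals starting in bucket [j] all contain [j + 1], so what [U]
   covers of the open cell ]j, j + 1[ is ]j, j + lcov U j] and
   [j + 1 - rcov U j, j + 1[, coming from the buckets [j - 1] and [j]. *)
Definition lcov (U : {set 'I_n}) (j : nat) : R :=
  \big[Num.max/0]_(i | (i \in U) && ((bucket i).+1 == j)) frac i.
Definition rcov (U : {set 'I_n}) (j : nat) : R :=
  \big[Num.max/0]_(i | (i \in U) && (bucket i == j)) (1 - frac i).

Lemma bigmax_setU1 (P : pred 'I_n) (F : 'I_n -> R) (U : {set 'I_n}) i :
  i \notin U ->
  \big[Num.max/0]_(t | (t \in i |: U) && P t) F t =
  if P i then Num.max (F i) (\big[Num.max/0]_(t | (t \in U) && P t) F t)
  else \big[Num.max/0]_(t | (t \in U) && P t) F t.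
Proof.
move=> iU; case: ifP => Pi.
  rewrite (bigmaxD1 i); last by rewrite !inE eqxx.
  congr Num.max; apply: eq_bigl => t; rewrite !inE.
  by have [->|] := eqVneq t i; rewrite ?(negbTE iU) ?andbF ?andbT.
apply: eq_bigl => t; rewrite !inE.
by have [->|] := eqVneq t i; rewrite ?(negbTE iU) ?Pi.
Qed.

(** Together with [rcov_setU1]: an acceptance changes one left value and one right value, so two
    stores update the tables. *)
Lemma lcov_setU1 (U : {set 'I_n}) i j : i \notin U -> lcov (i |: U) j =
  if (bucket i).+1 == j then Num.max (frac i) (lcov U j) else lcov U j.
Proof. exact: (bigmax_setU1 (fun t => (bucket t).+1 == j)). Qed.

Lemma rcov_setU1 (U : {set 'I_n}) i j : i \notin U -> rcov (i |: U) j =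
  if bucket i == j then Num.max (1 - frac i) (rcov U j) else rcov U j.
Proof. exact: (bigmax_setU1 (fun t => bucket t == j)). Qed.

Lemma lcov0 j : lcov finset.set0 j = 0.
Proof. by apply: big_pred0 => t; rewrite inE. Qed.

Lemma rcov0 j : rcov finset.set0 j = 0.
Proof. by apply: big_pred0 => t; rewrite inE. Qed.

Lemma lcov_ge0 (U : {set 'I_n}) j : 0 <= lcov U j.
Proof. exact: bigmax_ge_id. Qed.

Lemma rcov_ge0 (U : {set 'I_n}) j : 0 <= rcov U j.
Proof. exact: bigmax_ge_id. Qed.

Context (a : R) (unitV : unit_length_in a V).

Lemma frac_itv i : 0 <= frac i < 1.
Proof.
have [start0 _ _] := unitV i; have := truncn_itv start0; rewrite -natr1 => /andP[? ?].
by apply/andP; split; rewrite /frac /bucket; lra.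
Qed.

Lemma start_bucket i : (V i).1 = (bucket i)%:R + frac i.
Proof. by rewrite addrC subrK. Qed.

(** The default 0 of the maxima is harmless because the cell is open: when no interval contributes,
    the corresponding condition on [x] is false. *)
Lemma covered_cell (U : {set 'I_n}) (j : nat) (x : R) :
  j%:R < x < j%:R + 1 ->
  covered V U x <-> x <= j%:R + lcov U j \/ j%:R + 1 - rcov U j <= x.
Proof.
move=> /andP[jx xj]; split.
  case=> i /= iU; rewrite in_itv/= (right_end unitV) => /andP[ix xi].
  have /andP[f0 f1] := frac_itv i; have oE := start_bucket i.
  have bj : (bucket i <= j)%N by rewrite -ltnS -(ltr_nat R) -natr1; lra.
  have jb : (j <= (bucket i).+1)%N by rewrite -ltnS -(ltr_nat R) -!natr1; lra.
  move: bj; rewrite leq_eqVlt => /predU1P[bj|bj].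
    right; have : 1 - frac i <= rcov U j by apply: le_bigmax_cond; rewrite iU bj eqxx.
    by rewrite bj in oE; lra.
  have {bj jb} jE : (bucket i).+1 = j by apply/eqP; rewrite eqn_leq bj.
  left; have : frac i <= lcov U j by apply: le_bigmax_cond; rewrite iU jE eqxx.
  by rewrite -jE -natr1; lra.
move=> cov; have [//|ncov] := pselect (covered V U x).
have ends i : i \in U -> x < (V i).1 \/ (V i).1 + 1 < x.
  move=> iU; have [|ix] := ltP x (V i).1; first by left.
  have [|xi] := ltP ((V i).1 + 1) x; first by right.
  by case: ncov; exists i; rewrite //= in_itv/= (right_end unitV) ix xi.
have lx : lcov U j < x - j%:R.
  apply/bigmax_ltP; split => [|i /andP[iU /eqP jE]]; first lra.
  have := frac_itv i; have := start_bucket i; have := ends _ iU.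
  by rewrite -jE -natr1 in jx xj *; lra.
have rx : rcov U j < j%:R + 1 - x.
  apply/bigmax_ltP; split => [|i /andP[iU /eqP jE]]; first lra.
  have := frac_itv i; have := start_bucket i; have := ends _ iU.
  by rewrite -jE in jx xj *; lra.
by case: cov; lra.
Qed.

(** The interval [V i] meets cell [j] to the right of [frac i] and cell [j.+1] to the left of it. In
    each cell the part it newly covers is, up to finitely many points, a single interval. *)
Lemma gain_cells (U : {set 'I_n}) (i : 'I_n) : let j := bucket i in
  gain V U i =
  Num.max 0 (1 - rcov U j - Num.max (frac i) (lcov U j)) +
  Num.max 0 (Num.min (frac i) (1 - rcov U j.+1) - lcov U j.+1).
Proof.
move=> j; have /andP[f0 f1] := frac_itv i.
have oE : (V i).1 = j%:R + frac i := start_bucket i.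
have l0 := lcov_ge0 U j; have r0 := rcov_ge0 U j.
have l0' := lcov_ge0 U j.+1; have r0' := rcov_ge0 U j.+1.
have cell := @covered_cell U j; have cell' := @covered_cell U j.+1.
rewrite -natr1 in cell'.
set u := Num.max (frac i) _; set v := Num.min _ _.
have uE x : u < x = (frac i < x) && (lcov U j < x) by rewrite /u gt_max.
have vE x : x < v = (x < frac i) && (x < 1 - rcov U j.+1) by rewrite /v lt_min.
pose A : set R := `]j%:R + u, j%:R + 1 - rcov U j[%classic.
pose B : set R := `]j%:R + 1 + lcov U j.+1, j%:R + 1 + v[%classic.
(* The ends of [V i] and the border of the two cells, which the open intervals [A] and [B] leave
   out, form a null set. *)
pose F : set R := [set j%:R + frac i; j%:R + 1; j%:R + 1 + frac i]%classic.
have mA : measurable A by exact: measurable_itv.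
have mB : measurable B by exact: measurable_itv.
have mF : measurable F by apply: measurableU => //; apply: measurableU.
have F0 : mu F = 0%E.
  by apply: countable_lebesgue_measure0; apply: finite_set_countable; rewrite !finite_setU.
have AP x : A x <-> [/\ frac i < x - j%:R, lcov U j < x - j%:R & x < j%:R + 1 - rcov U j].
  rewrite /A /= in_itv/= -ltrBrDl uE; split; first by case/andP => /andP[].
  by case=> -> -> ->.
have BP x : B x <-> [/\ x - (j%:R + 1) < frac i, x - (j%:R + 1) < 1 - rcov U j.+1
    & j%:R + 1 + lcov U j.+1 < x].
  rewrite /B /= in_itv/= -ltrBlDl vE; split; first by case/andP => -> /andP[].
  by case=> -> -> ->.
have AB : mu (A `|` B)%classic = (Num.max 0 (1 - rcov U j - u) +
    Num.max 0 (v - lcov U j.+1))%:E.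
  rewrite mu_disjU// => [|x /AP[_ _ ?] /BP[_ _ ?]]; last lra.
  by rewrite !itv_measure -EFinD; congr (Num.max 0 _ + Num.max 0 _)%:E; lra.
apply: EFin_inj; rewrite -AB gainE; apply/eqP; rewrite eq_le; apply/andP; split.
  apply: (@le_trans _ _ (mu ((A `|` B) `|` F)%classic)); last first.
    apply: le_trans (mu_U2 _ _) _ => //; first exact: measurableU.
    by rewrite [X in (_ + X)%E]F0 adde0.
  apply: le_mu; [exact: measurable_uncovered| |].
    by apply: measurableU => //; exact: measurableU.
  move=> x [/=]; rewrite in_itv/= (right_end unitV) oE => /andP[ix xi] ncov.
  have [|xi'] := eqVneq x (j%:R + frac i); first by right; left; left.
  have [|xj] := eqVneq x (j%:R + 1); first by right; left; right.
  have [|xe] := eqVneq x (j%:R + 1 + frac i); first by right; right.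
  left; have {}ix : j%:R + frac i < x by rewrite lt_neqAle eq_sym xi'.
  have {}xi : x < j%:R + 1 + frac i by rewrite lt_neqAle xe; lra.
  move: xj; rewrite neq_lt => /orP[xj|jx].
    left; apply/AP; have [|_ ncell] := cell x; first by apply/andP; split; lra.
    split; first lra.
      by rewrite ltNge; apply/negP => h; apply/ncov/ncell; left; lra.
    by rewrite ltNge; apply/negP => h; apply/ncov/ncell; right; lra.
  right; apply/BP; have [|_ ncell] := cell' x; first by apply/andP; split; lra.
  split; first lra.
    by rewrite ltNge; apply/negP => h; apply/ncov/ncell; right; lra.
  by rewrite ltNge; apply/negP => h; apply/ncov/ncell; left; lra.
apply: le_mu; [exact: measurableU|exact: measurable_uncovered|].
move=> x; case=> [/AP[? ? ?]|/BP[? ? ?]]; split.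
- by rewrite /= in_itv/= (right_end unitV) oE; apply/andP; split; lra.
- have [|+ _] := cell x; first by apply/andP; split; lra.
  by move=> h /h; case; lra.
- by rewrite /= in_itv/= (right_end unitV) oE; apply/andP; split; lra.
- have [|+ _] := cell' x; first by apply/andP; split; lra.
  by move=> h /h; case; lra.
Qed.

End Buckets.

(* [eval] and [Sub] are also names of the libraries. *)
Import Defs.

(** * Loop-free programs and their running time *)

Fixpoint loop_free (c : cmd) : bool :=
  match c with
  | Skip | Store _ _ => true
  | Seq c1 c2 | If _ _ c1 c2 => loop_free c1 && loop_free c2
  | While _ _ _ => false
  end.

Fixpoint time_bound (c : cmd) : nat :=
  match c with
  | Skip | While _ _ _ => 1
  | Store e1 e2 => (cost e1 + cost e2).+1
  | Seq c1 c2 => (time_bound c1 + time_bound c2).+1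
  | If e1 e2 c1 c2 => (cost e1 + cost e2 + (time_bound c1 + time_bound c2)).+1
  end.

Section LoopFree.
Context {R : realType}.

Fixpoint run (c : cmd) (m : memory (R := R)) : memory :=
  match c with
  | Skip | While _ _ _ => m
  | Store e1 e2 => upd m (Num.truncn (eval m e1)) (eval m e2)
  | Seq c1 c2 => run c2 (run c1 m)
  | If e1 e2 c1 c2 => if eval m e1 <= eval m e2 then run c1 m else run c2 m
  end.

(** Without loops, execution is a function of the memory: correctness is proved by computing [run],
    and the time bound depends on the program text alone. *)
Lemma exec_run (c : cmd) (m : memory) : loop_free c ->
  exists2 t, exec c m (run c m) t & (t <= time_bound c)%N.
Proof.
elim: c m => [|e1 e2|c1 IH1 c2 IH2|e1 e2 c1 IH1 c2 IH2|//] m /=.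
- by move=> _; exists 1%N => //; exact: ExecSkip.
- by move=> _; exists (cost e1 + cost e2).+1 => //; exact: ExecStore.
- move=> /andP[/(IH1 m)[t1 ex1 le1] /(IH2 (run c1 m))[t2 ex2 le2]].
  by exists (t1 + t2).+1; [exact: ExecSeq ex1 ex2|rewrite ltnS leq_add].
- move=> /andP[/(IH1 m)[t1 ex1 le1] /(IH2 m)[t2 ex2 le2]]; case: leP => e12.
    exists (cost e1 + cost e2 + t1).+1; first exact: ExecIfTrue.
    by rewrite ltnS leq_add2l (leq_trans le1) ?leq_addr.
  exists (cost e1 + cost e2 + t2).+1; first exact: ExecIfFalse.
  by rewrite ltnS leq_add2l (leq_trans le2) ?leq_addl.
Qed.

End LoopFree.

(** * The program for SOA *)

Definition Abs e := Sqrt (Mul e e).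
(** Expressions have no conditional, so extrema are obtained as half of [x + y] plus or minus
    [|x - y|]. *)
Definition Max e1 e2 := Div (Add (Add e1 e2) (Abs (Sub e1 e2))) (Cst 2).
Definition Min e1 e2 := Div (Sub (Add e1 e2) (Abs (Sub e1 e2))) (Cst 2).

(* Cell 0 holds the number of releases still to come, cell 1 the quota left,
   cells 2 and 3 the current release, cell 4 the answer, cell 5 the threshold;
   cells [10 + 2 j] and [11 + 2 j] hold [lcov Phi j] and [rcov Phi j]. *)
Definition cell c := Mem (Cst c).
Definition Bucket := Floor (cell 2).
Definition Frac := Sub (cell 2) Bucket.
Definition addr c := Add (Cst c) (Mul (Cst 2) Bucket).

Definition Theta :=
  let K := cell 1 in let N := cell 0 in
  Min
    (Div (Sub (Sqrt (Add (Cst 1)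
           (Mul (Mul (Cst 2) (Sub K (Cst 1))) (Sub N K)))) (Cst 1))
         (Sub (Mul (Cst 2) K) (Cst 2)))
    (Div (Sub (Sub (Sqrt (Add (Sub (Mul (Cst 9) (Mul K K)) (Mul (Cst 14) K))
           (Cst 9))) K) (Cst 1))
         (Mul (Cst 4) (Sub K (Cst 1)))).

(** Transcribes [gain_cells]; offsets 12 and 13 reach the entries of the next bucket. *)
Definition Gain :=
  Add (Max (Cst 0) (Sub (Sub (Cst 1) (Mem (addr 11))) (Max Frac (Mem (addr 10)))))
      (Max (Cst 0) (Sub (Min Frac (Sub (Cst 1) (Mem (addr 13)))) (Mem (addr 12)))).

(** The threshold is computed while cells 0 and 1 still hold [n] and [k], before they become
    decreasing counters. *)
Definition SOA_init := Store (Cst 5) Theta.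

Definition decide_cmd :=
  If (cell 1) (Cst 0) (Store (Cst 4) (Cst 0))
    (If (cell 0) (cell 1) (Store (Cst 4) (Cst 1))
       (If (cell 5) Gain (Store (Cst 4) (Cst 1)) (Store (Cst 4) (Cst 0)))).

Definition accept_cmd :=
  Seq (Store (Cst 1) (Sub (cell 1) (Cst 1)))
  (Seq (Store (addr 11) (Max (Sub (Cst 1) Frac) (Mem (addr 11))))
       (Store (addr 12) (Max Frac (Mem (addr 12))))).

(** Cell 0 is decremented only after the decision, whose quota-enough test counts the current
    release. *)
Definition SOA_handler :=
  Seq decide_cmd
  (Seq (Store (Cst 0) (Sub (cell 0) (Cst 1)))
       (If (cell 4) (Cst 0) Skip accept_cmd)).

(** * Correctness and linear running time of the program *)

Section Simulation.
Set Implicit Arguments.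
Unset Strict Implicit.
Context {R : realType}.
Implicit Types m : memory (R := R).

Lemma eval_Add m e1 e2 : eval m (Add e1 e2) = eval m e1 + eval m e2.
Proof. by []. Qed.

Lemma eval_Sub m e1 e2 : eval m (Sub e1 e2) = eval m e1 - eval m e2.
Proof. by []. Qed.

Lemma eval_Max m e1 e2 : eval m (Max e1 e2) = Num.max (eval m e1) (eval m e2).
Proof. by rewrite maxr_absE /= -expr2 sqrtr_sqr. Qed.

Lemma eval_Min m e1 e2 : eval m (Min e1 e2) = Num.min (eval m e1) (eval m e2).
Proof. by rewrite minr_absE /= -expr2 sqrtr_sqr. Qed.

Lemma eval_cell m c : eval m (cell c) = m c.
Proof. by rewrite /= natrK. Qed.

Lemma run_Store_cell m c e : run (Store (Cst c) e) m = upd m c (eval m e).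
Proof. by rewrite /= natrK. Qed.

Context (k n : nat) (k2 : (2 <= k)%N) (kn : (k < n)%N).
Context (a : R) (V : intervals n) (unitV : unit_length_in a V).

Definition represents (m : memory) (Phi : {set 'I_n}) (r : nat) :=
  [/\ m 0%N = r%:R, m 1%N = (k - #|Phi|)%:R, m 5%N = theta k n,
      forall j, m (10 + 2 * j)%N = lcov V Phi j
    & forall j, m (11 + 2 * j)%N = rcov V Phi j].

(** Zero-filled memory already holds the tables of the empty set, so initialization takes constant
    time. *)
Lemma represents_init :
  represents (run SOA_init (start n k)) finset.set0 n.
Proof.
rewrite /SOA_init run_Store_cell; split => [|||j|j].
- by [].
- by rewrite /upd /= cards0 subn0.
- by rewrite /upd eqxx /Theta eval_Min /= !natrK /upd /= /theta expr2.
- by rewrite lcov0.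
- by rewrite rcov0.
Qed.

Lemma eval_Bucket m i : m 2%N = (V i).1 -> eval m Bucket = (bucket V i)%:R.
Proof.
move=> m2; have [start_ge0 _ _] := unitV i.
rewrite /Bucket [LHS]/= natrK m2 /bucket truncn_floor start_ge0.
by rewrite -[in LHS](gez0_abs (_ : 0 <= Num.floor (V i).1)) ?floor_ge0.
Qed.

Lemma eval_Frac m i : m 2%N = (V i).1 -> eval m Frac = frac V i.
Proof. by move=> m2; rewrite -[LHS]/(eval m (cell 2) - eval m Bucket) (eval_Bucket m2) eval_cell m2. Qed.

Lemma eval_addr m i c : m 2%N = (V i).1 ->
  Num.truncn (eval m (addr c)) = (c + 2 * bucket V i)%N.
Proof.
by move=> m2; rewrite -[eval _ _]/(c%:R + 2%:R * eval m Bucket)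
  (eval_Bucket m2) -natrM -natrD natrK.
Qed.

Lemma eval_Mem_addr m i c : m 2%N = (V i).1 ->
  eval m (Mem (addr c)) = m (c + 2 * bucket V i)%N.
Proof. by move=> m2; rewrite -(eval_addr c m2). Qed.

Lemma eval_Gain m Phi r i : represents m Phi r -> m 2%N = (V i).1 ->
  eval m Gain = gain V Phi i.
Proof.
case=> _ _ _ mL mR m2.
rewrite /Gain eval_Add !eval_Max !eval_Sub eval_Max eval_Min eval_Sub (eval_Frac m2).
rewrite !(eval_Mem_addr _ m2) (gain_cells unitV).
have -> : (12 + 2 * bucket V i = 10 + 2 * (bucket V i).+1)%N by lia.
have -> : (13 + 2 * bucket V i = 11 + 2 * (bucket V i).+1)%N by lia.
by rewrite !mL !mR.
Qed.

Lemma run_decide m Phi (i : 'I_n) :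
  represents m Phi (n - i)%N -> m 2%N = (V i).1 ->
  (forall j, j \in Phi -> (j < i)%N) -> (#|Phi| <= k)%N ->
  run decide_cmd m = upd m 4 (SOA_accepts k V Phi i)%:R.
Proof.
move=> repr m2 ltPhi Phik; have [m0 m1 m5 _ _] := repr.
rewrite /decide_cmd; cbn [run]; rewrite !eval_cell m0 m1 m5 (eval_Gain repr m2).
rewrite -![Num.truncn _]/(Num.truncn _) !natrK.
rewrite (SOA_acceptsE k2 kn unitV)// [eval m (Cst 0)]/= lern0 !ler_nat lt0n.
case: eqVneq => //= _; case: leqP => //= _; by case: (theta k n <= _).
Qed.

(** Left values sit at even addresses and right values at odd ones, all from 10 on, so the two table
    stores disturb neither each other nor the low cells. *)
Lemma run_accept m Phi (i : 'I_n) r :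
  represents m Phi r -> m 2%N = (V i).1 -> i \notin Phi -> (#|Phi| < k)%N ->
  represents (run accept_cmd m) (i |: Phi) r /\ run accept_cmd m 4%N = m 4%N.
Proof.
case=> m0 m1 m5 mL mR m2 iPhi Phik; rewrite /accept_cmd; cbn [run].
rewrite [Num.truncn (eval m (Cst 1))]natrK.
set m' := upd m 1 _; have m'2 : m' 2%N = (V i).1 by [].
rewrite (eval_addr _ m'2) eval_Max (eval_Mem_addr _ m'2).
rewrite eval_Sub (eval_Frac m'2).
set m'' := upd m' _ _; have m''2 : m'' 2%N = (V i).1 by rewrite /m'' /upd.
rewrite (eval_addr _ m''2) eval_Max (eval_Mem_addr _ m''2) (eval_Frac m''2).
have m''L j : m'' (10 + 2 * j)%N = lcov V Phi j.
  rewrite /m'' /upd; case: eqP => [|_]; first lia.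
  by rewrite /m' /upd -mL.
have m''R j : m'' (11 + 2 * j)%N = rcov V (i |: Phi) j.
  rewrite rcov_setU1// /m'' /upd; have [<-|ij] := eqVneq (bucket V i) j.
    by rewrite eqxx -mR.
  by case: eqP => [|_]; [lia|rewrite -mR].
have -> : (12 + 2 * bucket V i = 10 + 2 * (bucket V i).+1)%N by lia.
rewrite m''L; split; last first.
  by rewrite /m'' /upd; case: eqP => [|_]; [lia|case: eqP => [|//]; lia].
split => [|||j|j].
- by [].
- rewrite /m'' /m' /upd /= ?natrK m1 cardsU1 iPhi -natrB; last by rewrite subn_gt0.
  by congr _%:R; lia.
- by [].
- rewrite lcov_setU1// /upd; have [<-|ij] := eqVneq (bucket V i).+1 j.
    by rewrite eqxx.
  by case: eqP => [|_]; [lia|rewrite m''L].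
- by rewrite -m''R /upd; case: eqP => // ?; lia.
Qed.

Let step (Phi : {set 'I_n}) i := if SOA_accepts k V Phi i then i |: Phi else Phi.

Lemma run_handler m Phi (i : 'I_n) r :
  represents m Phi r.+1 -> r.+1 = (n - i)%N ->
  (forall j, j \in Phi -> (j < i)%N) -> (#|Phi| <= k)%N ->
  let m' := run SOA_handler (release m (V i)) in
  [/\ represents m' (step Phi i) r, (#|step Phi i| <= k)%N
    & (m' 4%N != 0) = SOA_accepts k V Phi i].
Proof.
move=> repr rE ltPhi Phik.
have iPhi : i \notin Phi by apply/negP => /ltPhi; rewrite ltnn.
rewrite /SOA_handler; set m1 := release _ _.
have repr1 : represents m1 Phi (n - i)%N by rewrite -rE; case: repr.
have m12 : m1 2%N = (V i).1 by [].
cbn [run]; rewrite (run_decide repr1 m12 ltPhi Phik).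
set b := SOA_accepts _ _ _ _.
rewrite [Num.truncn (eval _ (Cst 0))]natrK eval_Sub.
rewrite eval_cell; set m2 := upd (upd m1 _ _) _ _.
have m22 : m2 2%N = (V i).1 by [].
have m24 : m2 4%N = b%:R by [].
have repr2 : represents m2 Phi r.
  case: repr1 => m10 ? ? mL mR; split => //.
  by rewrite -[m2 0%N]/(eval (upd m1 4 b%:R) (cell 0) - 1) eval_cell
    -[upd _ _ _ _]/(m1 0%N) m10 -rE -natr1 addrK.
rewrite m24 -[eval _ _]/(0%:R) ler_nat leqn0 /step -/b.
have : b -> (#|Phi| < k)%N.
  by rewrite /b (SOA_acceptsE k2 kn unitV)// subn_gt0 => /andP[].
clearbody m2 b; case: b m24 => m24 /= Phik'.
- have [repr3 acc4] := run_accept repr2 m22 iPhi (Phik' isT).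
  split => //; first by rewrite cardsU1 iPhi Phik'.
  by rewrite [X in X != 0]acc4 m24 oner_neq0.
- by split => //; rewrite m24 eqxx.
Qed.

(** Decisions are irrevocable, so the answer given at a release is membership in the final set. *)
Lemma mem_foldl_step (s : seq 'I_n) (Phi : {set 'I_n}) i :
  i \notin s -> (i \in foldl step Phi s) = (i \in Phi).
Proof.
elim: s Phi => //= x s IHs Phi; rewrite inE negb_or => /andP[ix is'].
by rewrite IHs// /step; case: ifP => // _; rewrite !inE (negbTE ix).
Qed.

(** Stated for a suffix [s] of the releases, to allow induction. The successor in the time bound
    pays for writing each release into memory. *)
Lemma serve_SOA (s : seq 'I_n) (Phi : {set 'I_n}) m :
  map val s = iota (n - size s) (size s) -> (size s <= n)%N ->
  (forall j, j \in Phi -> (j < n - size s)%N) -> (#|Phi| <= k)%N ->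
  represents m Phi (size s) ->
  exists2 t, serve SOA_handler m [seq V i | i <- s]
                   [seq i \in foldl step Phi s | i <- s] t
           & (t <= (time_bound SOA_handler).+1 * size s)%N.
Proof.
elim: s Phi m => [|x s IHs] Phi m.
  by move=> *; exists 0%N => //; exact: ServeNil.
rewrite [size _]/= [map val _]/= => vals sn ltPhi Phik repr.
have [xE valsE] : (val x = n - (size s).+1)%N /\ map val s = iota (n - size s) (size s).
  by move: vals => /= [-> ->]; split => //; congr iota; lia.
have rE : (size s).+1 = (n - x)%N by rewrite [nat_of_ord x]xE; lia.
have ltPhix j : j \in Phi -> (j < x)%N by move=> /ltPhi; rewrite -xE.
have xPhi : x \notin Phi by apply/negP => /ltPhix; rewrite ltnn.
have xs : x \notin s.
  apply/negP => /(map_f val); rewrite valsE mem_iota xE; lia.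
have [repr' card' out] := run_handler repr rE ltPhix Phik.
have [//|t1 ex1 le1] := @exec_run R SOA_handler (release m (V x)).
have ltPhi' j : j \in step Phi x -> (j < n - size s)%N.
  rewrite /step; case: ifP => _; last by move=> /ltPhi; lia.
  by rewrite !inE => /predU1P[->|/ltPhi]; [rewrite [nat_of_ord x]xE|]; lia.
have [t2 ex2 le2] := IHs (step Phi x) _ valsE (ltnW sn) ltPhi' card' repr'.
exists (t1 + t2).+1; last by rewrite mulnS addSn ltnS leq_add.
have acc : SOA_accepts k V Phi x = (x \in foldl step Phi (x :: s)).
  rewrite -[foldl _ _ _]/(foldl step (step Phi x) s) mem_foldl_step//.
  by rewrite /step; case: ifP => _; rewrite ?inE ?eqxx ?(negbTE xPhi).
have := ServeCons ex1 ex2; rewrite out acc; exact.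
Qed.

Lemma SOA_decides : exists2 t, decides SOA_init SOA_handler k V (SOA k V) t &
  (t <= (time_bound SOA_init + (time_bound SOA_handler).+1) * n)%N.
Proof.
have [//|t0 ex0 le0] := @exec_run R SOA_init (start n k).
have := @serve_SOA (enum 'I_n) finset.set0 (run SOA_init (start n k)).
rewrite val_enum_ord size_enum_ord subnn cards0.
case=> // [j||t1 ex1 le1]; [by rewrite inE|exact: represents_init|].
exists (t0 + t1)%N.
  by exists (run SOA_init (start n k)), t0, t1.
(* As [n] is positive, the constant cost of initialization is at most [n] times itself. *)
rewrite mulnDl leq_add// (leq_trans le0)// leq_pmulr//.
exact: leq_ltn_trans kn.
Qed.

End Simulation.

Theorem theorem4 (R : realType) :
  (exists (init handler : cmd) (C : nat),
     forall (k n : nat), (2 <= k)%N -> (k <= n - 1)%N ->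
     forall (a : R) (V : intervals n), unit_length_in a V ->
     exists t : nat,
       decides init handler k V (SOA k V) t /\ (t <= C * n)%N)
  /\
  (forall (k n : nat), (2 <= k)%N -> (k <= n - 1)%N ->
     competitive k (@SOA R k n)
       (Num.min
          ((Num.sqrt (1 + 2 * (k%:R - 1) * (n%:R - k%:R)) - 1)
             / (k%:R - 1) + 1)
          ((Num.sqrt (9 * k%:R ^+ 2 - 14 * k%:R + 9) - k%:R - 1)
             / (2 * (k%:R - 1)) + 1))).
Proof.
split.
  exists SOA_init, SOA_handler, (time_bound SOA_init + (time_bound SOA_handler).+1)%N.
  move=> k n k2 kn1 a V unitV; have kn : (k < n)%N by lia.
  by have [t dec le_t] := SOA_decides k2 kn unitV; exists t.
move=> k n k2 kn1 a V unitV; have kn : (k < n)%N by lia.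
rewrite ratio_eq//; exact: SOA_competitive unitV.
Qed.
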